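(* Let $f:\mathbb{R}\to\mathbb{R}$ be a function. (a) If $f$ is weakly Świątkowski, then $f$ is continuous if and only if $f$ has closed graph. (b) If $f$ is Świątkowski, then $f$ is continuous if and only if $f$ has closed graph.
   Context: A function $f:X\to\mathbb{R}$ has closed graph if its graph $\{\langle x,f(x)\rangle : x\in X\}$ is a closed subset of the product $X\times\mathbb{R}$. A function $f:X\to\mathbb{R}$ on a topological space $X$ is called Świątkowski if for any connected subset $C\subset X$ and points $a,b\in C$ with $f(a)<f(b)$ there exists a continuity point $x\in C$ of $f$ such that $f(a)<f(x)<f(b)$. A function $f:X\to\mathbb{R}$ on a topological space $X$ is called weakly Świątkowski if for any connected subset $C\subset X$ and points $a,b\in C$ with $f(a)<f(b)$ there exists a point $x\in C$ such that $f(a)<f(x)<f(b)$. Here these notions are applied with $X=\mathbb{R}$ carrying the usual topology. *)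

(* Defs.v *)
From mathcomp Require Import all_boot all_order all_algebra.
From mathcomp Require Import all_classical all_reals all_analysis.

Set Implicit Arguments.
Unset Strict Implicit.
Unset Printing Implicit Defensive.

Import numFieldNormedType.Exports.

Local Open Scope classical_set_scope.
Local Open Scope ring_scope.

Definition has_closed_graph (R : realType) (X : topologicalType) (f : X -> R) :
    Prop :=
  closed [set (x, f x) | x in [set: X]].

(* Continuity at [x] is that of [f] on the whole space, not of its restriction
   to [C]. *)
Definition swiatkowski (R : realType) (X : topologicalType) (f : X -> R) :
    Prop :=
  forall (C : set X) (a b : X), connected C -> C a -> C b -> f a < f b ->
    exists x : X, [/\ C x, {for x, continuous f} & f a < f x < f b].

Definition weakly_swiatkowski (R : realType) (X : topologicalType)
    (f : X -> R) : Prop :=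
  forall (C : set X) (a b : X), connected C -> C a -> C b -> f a < f b ->
    exists x : X, C x /\ f a < f x < f b.

(* Main.v *)
Require Import Defs.
From mathcomp Require Import all_boot all_order all_algebra.
From mathcomp Require Import all_classical all_reals all_analysis.

Import numFieldNormedType.Exports.
Import Order.TTheory GRing.Theory Num.Theory.

Local Open Scope classical_set_scope.
Local Open Scope ring_scope.

(** A continuous real function has closed graph, because its graph is the zero
    set of the continuous function [(x, y) |-> f x - y]. The converse is proved
    for weakly Świątkowski functions, and every Świątkowski function is one.

    Suppose that [f : R -> R] is weakly Świątkowski with closed graph, and let
    [K] be a segment. The image [f @` K] is closed, being the projection of a
    closed set along a compact factor ([closed_graph_image_compact]). It is also
    order-dense, by the weak Świątkowski property of the connected set [K]. A
    closed order-dense set of reals is an interval, since the two ends of a gap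
    would be points of the set with nothing in between
    ([closed_order_dense_interval]). Hence [f] has the intermediate value
    property on segments.

    The level sets of [f] are closed as well ([closed_graph_near_neq]), so
    for every [e > 0] some ball around [x] contains no point where [f] takes one
    of the values [f x - e] and [f x + e]. By the intermediate value property
    [f] stays strictly between these values on that ball, which is continuity
    at [x]. *)

Lemma continuous_closed_graph (R : realType) (X : topologicalType)
    (f : X -> R) :
  continuous f -> has_closed_graph f.
Proof.
move=> cf; rewrite /has_closed_graph.
have -> : [set (x, f x) | x in [set: X]] =
          (fun p : X * R => f p.1 - p.2) @^-1` [set x | x = 0].
  apply/seteqP; split=> [_ [x _ <-]|[x y]] /=; first by rewrite subrr.
  by move/eqP; rewrite subr_eq0 => /eqP <-; exists x.
apply: preimage_closed; last exact: closed_eq.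
move=> p _; apply: (@continuousB _ _ _ (fun p : X * R => f p.1) snd).
  by apply: (@continuous_comp _ _ _ fst f); [exact: cvg_fst|exact: cf].
exact: cvg_snd.
Qed.

Lemma closed_graph_near_neq (R : realType) (X : topologicalType) (f : X -> R)
    (x : X) (y : R) :
  has_closed_graph f -> f x <> y ->
  \forall x' \near x & y' \near y, f x' <> y'.
Proof.
move=> cf fxy; have : nbhs (x, y) (~` [set (x, f x) | x in [set: X]]).
  by apply: open_nbhs_nbhs; split; [exact: closed_openC|case=> z _ [-> ]].
by apply: filterS => -[x' y'] /= nG fx'; apply: nG; exists x'; rewrite ?fx'.
Qed.

(** Compactness of [K] turns the local disjointness of the graph from the line
    of height [y], around each point of [K], into one neighbourhood of [y]
    which misses all values on [K]. *)
Lemma closed_graph_image_compact (R : realType) (X : topologicalType)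
    (f : X -> R) (K : set X) :
  has_closed_graph f -> compact K -> closed (f @` K).
Proof.
move=> cf /compact_near_coveringP cK; rewrite -openC openE => y fKy.
have := cK _ (nbhs y) (fun y' x' => f x' <> y') _.
have near_neq x : K x -> \forall x' \near x & y' \near y, f x' <> y'.
  by move=> Kx; apply: closed_graph_near_neq => // fxy; apply: fKy; exists x.
move=> /(_ _ near_neq); apply: filterS => y' fK [x Kx fxy'].
exact: (fK x Kx).
Qed.

Lemma closed_order_dense_interval (R : realType) (S : set R) :
  closed S ->
  (forall a b, S a -> S b -> a < b -> exists2 c, S c & a < c < b) ->
  is_interval S.
Proof.
move=> cS dS a b Sa Sb y /andP[ay yb]; apply: contrapT => nSy.
have cptS u v : compact (S `&` `[u, v]).
  apply: (subclosed_compact _ (@segment_compact R u v)) => //.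
  by apply: closedI => //; exact: interval_closed.
have ida u v : {within S `&` `[u, v], continuous (@idfun R)}.
  by apply: continuous_subspaceT => x; exact: cvg_id.
(* The gap around [y]: [l] is the last point of [S] below it, [r] the first
   one above it. *)
have [|l /set_mem[Sl]] := @compact_EVT_max _ _ idfun _ _ (cptS a y) (ida a y).
  by exists a; split=> //=; rewrite in_itv /= lexx ay.
rewrite /= in_itv /= => /andP[al ly] lmax.
have [|r /set_mem[Sr]] := @compact_EVT_min _ _ idfun _ _ (cptS y b) (ida y b).
  by exists b; split=> //=; rewrite in_itv /= lexx yb.
rewrite /= in_itv /= => /andP[yr rb] rmin.
have {}ly : l < y.
  by rewrite lt_neqAle ly andbT; apply: contra_notN nSy => /eqP<-.
have [c Sc /andP[lc cr]] := dS l r Sl Sr (lt_le_trans ly yr).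
have [cy|/ltW yc] := leP c y.
- have /lmax/= : c \in S `&` `[a, y].
    apply/mem_set; split=> //=.
    by rewrite in_itv /= cy (ltW (le_lt_trans al lc)).
  by rewrite leNgt lc.
- have /rmin/= : c \in S `&` `[y, b].
    apply/mem_set; split=> //=.
    by rewrite in_itv /= yc (ltW (lt_le_trans cr rb)).
  by rewrite leNgt cr.
Qed.

Lemma weakly_swiatkowski_image_interval (R : realType) (X : topologicalType)
    (f : X -> R) (K : set X) :
  weakly_swiatkowski f -> has_closed_graph f -> compact K -> connected K ->
  is_interval (f @` K).
Proof.
move=> wf cf cptK conK; apply: closed_order_dense_interval.
  exact: closed_graph_image_compact.
move=> _ _ [x Kx <-] [y Ky <-] fxy.
by have [z [Kz fz]] := wf K x y conK Kx Ky fxy; exists (f z) => //; exists z.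
Qed.

Lemma weakly_swiatkowski_closed_graph_continuous (R : realType) (f : R -> R) :
  weakly_swiatkowski f -> has_closed_graph f -> continuous f.
Proof.
move=> wf cf x; apply/cvgrPdist_lt => e e0.
have near_level c : f x <> c -> \forall x' \near x, f x' <> c.
  move=> /(@closed_graph_near_neq _ _ _ _ _ cf)[[A B] [/= Ax Bc] AB].
  apply: filterS Ax => x' Ax'; apply: (AB (x', c)); split=> //.
  exact: nbhs_singleton.
have : \forall x' \near x, f x' <> f x + e /\ f x' <> f x - e.
  apply: filterI; apply: near_level; apply/eqP.
    by rewrite lt_eqF// ltrDl.
  by rewrite gt_eqF// ltrBlDr ltrDl.
move=> /nbhs_ballP[d /= d0 dball]; apply/nbhs_ballP; exists d => //= y yd.
have sub_ball : `[Num.min x y, Num.max x y] `<=` ball x d.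
  move: yd; rewrite ball_itv /= ltr_distlC => /andP[yl yr] z.
  rewrite /= in_itv /= => /andP[mz zM]; rewrite in_itv /=; apply/andP; split.
    by apply: lt_le_trans mz; rewrite lt_min yl andbT ltrBlDr ltrDl.
  by apply: le_lt_trans zM _; rewrite gt_max yr andbT ltrDl.
have itvf : is_interval (f @` `[Num.min x y, Num.max x y]).
  apply: weakly_swiatkowski_image_interval => //; first exact: segment_compact.
  by apply/connected_intervalP; exact: interval_is_interval.
have fx : (f @` `[Num.min x y, Num.max x y]) (f x).
  by exists x => //=; rewrite in_itv /= ge_min le_max !lexx.
have fy : (f @` `[Num.min x y, Num.max x y]) (f y).
  by exists y => //=; rewrite in_itv /= ge_min le_max !lexx !orbT.
have [ly ry] : f x - e < f y /\ f y < f x + e.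
  split; rewrite ltNge; apply/negP => fye.
  - have [|z zK fz] := itvf _ _ fy fx (f x - e).
      by rewrite fye/= gerBl ltW.
    by have [_] := dball _ (sub_ball _ zK).
  - have [|z zK fz] := itvf _ _ fx fy (f x + e).
      by rewrite fye andbT lerDl ltW.
    by have [+ _] := dball _ (sub_ball _ zK).
by rewrite /= distrC ltr_distl ly ry.
Qed.

Lemma swiatkowskiW (R : realType) (X : topologicalType) (f : X -> R) :
  swiatkowski f -> weakly_swiatkowski f.
Proof.
by move=> sf C a b conC Ca Cb /(sf C a b conC Ca Cb)[x [Cx _ fx]]; exists x.
Qed.

Theorem corollary1 (R : realType) (f : R -> R) :
  (weakly_swiatkowski f -> (continuous f <-> has_closed_graph f)) /\
  (swiatkowski f -> (continuous f <-> has_closed_graph f)).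
Proof.
suff wf_iff : weakly_swiatkowski f -> (continuous f <-> has_closed_graph f).
  by split=> // /swiatkowskiW.
move=> wf; split; first exact: continuous_closed_graph.
exact: weakly_swiatkowski_closed_graph_continuous.
Qed.
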